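(* The action of the multiplicative semigroup $\mathbb{N}$ on $\mathbb{T}=\mathbb{R}/\mathbb{Z}$ given by $n\cdot x=nx\bmod 1$ is weakly IC-rigid.
   Context: $\mathbb{N}=\{1,2,\dots\}$. $\mathcal{K}(\mathbb{T})$ is the space of nonempty compact subsets of $\mathbb{T}$ with the Hausdorff metric, on which $n\in\mathbb{N}$ acts by $A\mapsto nA=\{na \bmod 1: a\in A\}$. An invariant random compact (IRC) is a Borel probability measure $\mu$ on $\mathcal{K}(\mathbb{T})$ invariant under this action (the pushforward of $\mu$ under each $n\in\mathbb{N}$ equals $\mu$). $\mathcal{K}_{\mathrm{ct}}(\mathbb{T})$ is the set of countable (finite or countably infinite) members of $\mathcal{K}(\mathbb{T})$; it is coanalytic, hence measurable for the completion $\tilde\mu$ of any Borel probability measure $\mu$. The action is weakly IC-rigid if the only IRC $\mu$ with $\tilde\mu(\mathcal{K}_{\mathrm{ct}}(\mathbb{T}))=0$ is the Dirac mass $\delta_{\mathbb{T}}$ at the point $\mathbb{T}\in\mathcal{K}(\mathbb{T})$. *)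

(* Defs.v *)
From HB Require Import structures.
From mathcomp Require Import all_boot all_order all_algebra.
From mathcomp Require Import lra.
From mathcomp Require Import all_classical all_reals all_analysis.
Import Order.TTheory GRing.Theory Num.Theory.
Import numFieldNormedType.Exports.

Set Implicit Arguments.
Unset Strict Implicit.
Unset Printing Implicit Defensive.

Local Open Scope classical_set_scope.
Local Open Scope ring_scope.

Definition integers (R : realType) : {pred R} := fun x => x \is a Num.int.

Fact integers_zmod_closed (R : realType) : zmod_closed (@integers R).
Proof. by split=> [|x y]; [exact: rpred0 | exact: rpredB]. Qed.

HB.instance Definition _ (R : realType) :=
  GRing.isZmodClosed.Build R (@integers R) (@integers_zmod_closed R).

(* T = R/Z as a quotient group; its metric is the quotient metric
   d(x, y) = inf { |a| : a in R, a mod Z = x - y }, for which the projection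
   is continuous and T is compact. *)
Definition circle (R : realType) :=
  Quotient.quot (GRing.ZmodClosed.clone R (@integers R) _).

HB.instance Definition _ (R : realType) := GRing.Zmodule.on (circle R).
HB.instance Definition _ (R : realType) := EqQuotient.on (circle R).
HB.instance Definition _ (R : realType) := isPointed.Build (circle R) 0.

Definition circle_proj (R : realType) (a : R) : circle R := \pi_(circle R)%qT a.

Section circle_metric.
Context {R : realType}.
Implicit Types (a b : R) (x y z : circle R).

Fact circle_proj_is_zmod_morphism : zmod_morphism (@circle_proj R).
Proof.
move=> a b; rewrite /circle_proj.
rewrite [LHS](Quotient.pi_add (GRing.ZmodClosed.clone R (@integers R) _)).
by rewrite (Quotient.pi_opp (GRing.ZmodClosed.clone R (@integers R) _)).
Qed.

HB.instance Definition _ :=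
  GRing.isZmodMorphism.Build R (circle R) (@circle_proj R) circle_proj_is_zmod_morphism.

Lemma circle_proj_eq a b : (circle_proj a == circle_proj b) = (a - b \is a Num.int).
Proof.
by rewrite -(Quotient.idealrBE (GRing.ZmodClosed.clone R (@integers R) _)).
Qed.

Lemma circle_proj_surj z : exists a, circle_proj a = z.
Proof. by exists (repr z); rewrite /circle_proj reprK. Qed.

Definition circle_norm z : R := inf [set `|a| | a in [set a | circle_proj a = z]].

Let norm_has_inf z : has_inf [set `|a| | a in [set a | circle_proj a = z]].
Proof.
split; first by have [a az] := circle_proj_surj z; exists `|a|, a.
by exists 0 => _ [a _ <-].
Qed.

Lemma circle_norm_proj a : circle_norm (circle_proj a) <= `|a|.
Proof. by apply: ge_inf; [exact: (norm_has_inf _).2 | exists a]. Qed.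

Lemma circle_norm_adherent z (e : R) : 0 < e ->
  exists2 a, circle_proj a = z & `|a| < circle_norm z + e.
Proof.
by move=> e0; have [_ [a za <-]] := inf_adherent e0 (norm_has_inf z); exists a.
Qed.

Lemma circle_norm0 : circle_norm 0 = 0.
Proof.
apply/eqP; rewrite eq_le; apply/andP; split.
  by have := circle_norm_proj 0; rewrite raddf0 normr0.
apply: lb_le_inf; first exact: (norm_has_inf 0).1.
by move=> _ [a _ <-].
Qed.

Lemma circle_norm_eq0 z : circle_norm z = 0 -> z = 0.
Proof.
move=> z0; have h0 : 0 < 2^-1 :> R by rewrite invr_gt0.
have [a az] := circle_norm_adherent z h0; rewrite z0 add0r => ah.
have [a0|a0] := eqVneq a 0; first by rewrite -az a0 raddf0.
have a_gt0 : 0 < `|a| by rewrite normr_gt0.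
have [b bz] := circle_norm_adherent z a_gt0; rewrite z0 add0r => ba.
have : a - b \is a Num.int by rewrite -circle_proj_eq az bz.
move=> /intrP[m abm]; have m1 : `|m%:~R| < 1 :> R.
  rewrite -abm (le_lt_trans (ler_normB _ _))//.
  rewrite (splitr 1) ltrD// ?mul1r//; exact: lt_trans ba ah.
move: m1; rewrite -intr_norm -[1]/(1%:~R) ltr_int => m1.
have m0 : m = 0 by apply/eqP; rewrite -normr_le0 -ltzD1 add0r.
by move: abm ba; rewrite m0 => /subr0_eq ->; rewrite ltxx.
Qed.

Lemma circle_normN z : circle_norm (- z) = circle_norm z.
Proof.
wlog suff H : z / circle_norm (- z) <= circle_norm z.
  by apply/eqP; rewrite eq_le H/= -{1}(opprK z) H.
apply/ler_addgt0Pr => e e0; have [a az /ltW] := circle_norm_adherent z e0.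
apply: le_trans; have := circle_norm_proj (- a).
by rewrite raddfN/= az normrN.
Qed.

Lemma circle_normD y z : circle_norm (y + z) <= circle_norm y + circle_norm z.
Proof.
apply/ler_addgt0Pr => e e0; have e20 : 0 < e / 2 by rewrite divr_gt0.
have [a az /ltW Ha] := circle_norm_adherent y e20.
have [b bz /ltW Hb] := circle_norm_adherent z e20.
rewrite -az -bz -raddfD/= (le_trans (circle_norm_proj _))//.
rewrite (le_trans (ler_normD _ _))// (splitr e) addrACA az bz.
exact: lerD.
Qed.

Definition circle_dist x y : R := circle_norm (x - y).

Fact circle_distxx x : circle_dist x x = 0.
Proof. by rewrite /circle_dist subrr circle_norm0. Qed.

Fact circle_dist_positivity x y : circle_dist x y = 0 -> x = y.
Proof. by move=> /circle_norm_eq0/subr0_eq. Qed.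

Fact circle_dist_sym x y : circle_dist x y = circle_dist y x.
Proof. by rewrite /circle_dist -opprB circle_normN. Qed.

Fact circle_dist_triangle y x z :
  circle_dist x z <= circle_dist x y + circle_dist y z.
Proof. by rewrite /circle_dist -(subrKA y x) circle_normD. Qed.

HB.instance Definition _ := @isMetric.Build R (circle R) circle_dist
  circle_distxx circle_dist_positivity circle_dist_sym circle_dist_triangle.

Lemma circle_mdistE x y : mdist x y = circle_norm (x - y).
Proof. by []. Qed.

Lemma circle_proj_continuous : continuous (@circle_proj R).
Proof.
move=> a; apply/cvg_ballP => e e0; apply/nbhs_ballP; exists e => //= b.
move=> abe; rewrite ballEmdist/= circle_mdistE -raddfB.
exact: le_lt_trans (circle_norm_proj _) abe.
Qed.

Lemma circle_norm_mulrn z n : circle_norm (z *+ n) <= circle_norm z *+ n.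
Proof.
elim: n => [|n IHn]; first by rewrite !mulr0n circle_norm0.
by rewrite !mulrS (le_trans (circle_normD _ _))// lerD2l.
Qed.

Lemma circle_mulrn_continuous n : continuous (fun z : circle R => z *+ n : circle R).
Proof.
move=> x; apply/(@cvg_ballP _ (circle R) _ _ (nbhs_filter x)) => e e0.
apply/nbhs_ballP; exists (e / n.+1%:R).
  by rewrite /= divr_gt0.
move=> y; rewrite !ballEmdist/= !circle_mdistE -mulrnBl ltr_pdivlMr// => xyn.
rewrite (le_lt_trans (circle_norm_mulrn _ _))// (le_lt_trans _ xyn)//.
rewrite -[leLHS]mulr_natr ler_wpM2l ?ler_nat//.
by rewrite -circle_mdistE mdist_ge0.
Qed.

Lemma circle_compact : compact [set: circle R].
Proof.
suff -> : [set: circle R] = @circle_proj R @` `[0, 1].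
  apply: continuous_compact; last exact: segment_compact.
  exact/continuous_subspaceT/circle_proj_continuous.
apply/seteqP; split => // z _; have [a <-] := circle_proj_surj z.
exists (a - (Num.floor a)%:~R).
  by rewrite /= in_itv/= subr_ge0 floor_le_tmp ltW// ltrBlDl -intrD1 floorD1_gt.
by apply/eqP; rewrite circle_proj_eq addrAC subrr sub0r rpredN intr_int.
Qed.

End circle_metric.

(* Nonempty compact subsets, to be equipped with the Hausdorff metric. *)
Record compacts (R : realType) (M : metricType R) := Compacts {
  kset :> set M ;
  kset_compact : compact kset ;
  kset_nonempty : kset !=set0 }.

HB.instance Definition _ (R : realType) (M : metricType R) :=
  gen_eqMixin (compacts M).
HB.instance Definition _ (R : realType) (M : metricType R) :=
  gen_choiceMixin (compacts M).

Section hausdorff_metric.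
Context {R : realType} {M : metricType R}.
Implicit Types A B C : compacts M.

Lemma compacts_eq A B : (A : set M) = B -> A = B.
Proof.
case: A B => [A cA A0] [B cB B0]/= AB; subst B.
by congr Compacts; exact: Prop_irrelevance.
Qed.

Definition thickening (A : set M) (r : R) : set M := \bigcup_(a in A) ball a r.

Definition hausdorff_dist A B : R :=
  inf [set r | [/\ 0 < r, A `<=` thickening B r & B `<=` thickening A r]].

Let hset A B :=
  [set r : R | [/\ 0 < r, A `<=` thickening B r & B `<=` thickening A r]].

Let thickening_le (A : set M) (r s : R) :
  r <= s -> thickening A r `<=` thickening A s.
Proof. by move=> rs x [a Aa arx]; exists a => //; exact: le_ball arx. Qed.

Let thickening_bounded A B :
  exists2 r : R, 0 < r & forall s, r <= s -> B `<=` thickening A s.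
Proof.
have [a Aa] := kset_nonempty A.
have ca : continuous (mdist a : M -> R).
  move=> x; apply/cvg_ballP => e e0; apply/nbhs_ballP; exists e => //= y.
  rewrite ballEmdist/= => xye; rewrite -ball_normE /= ltr_distl.
  have := metric_triangle a x y; have := metric_triangle a y x.
  by rewrite (metric_sym y x); lra.
have [b _ Hb] := compact_EVT_max (kset_nonempty B) (@kset_compact _ _ B)
  (continuous_subspaceT ca).
exists (mdist a b + 1) => [|s]; first by rewrite ltr_wpDl ?mdist_ge0.
move=> bs x Bx; exists a => //; rewrite ballEmdist/=.
by apply: lt_le_trans bs; rewrite (le_lt_trans (Hb _ (mem_set Bx)))// ltrDl.
Qed.

Let hset_has_inf A B : has_inf (hset A B).
Proof.
split; last by exists 0 => r [/ltW].
have [r r0 Hr] := thickening_bounded A B.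
have [s s0 Hs] := thickening_bounded B A.
exists (r + s); split; first exact: addr_gt0.
  by apply: Hs; rewrite lerDr ltW.
by apply: Hr; rewrite lerDl ltW.
Qed.

Lemma hausdorff_dist_le A B r :
  0 < r -> A `<=` thickening B r -> B `<=` thickening A r ->
  hausdorff_dist A B <= r.
Proof. by move=> *; apply: ge_inf; [exact: (hset_has_inf A B).2 | split]. Qed.

Lemma hausdorff_dist_gt A B r : hausdorff_dist A B < r ->
  [/\ 0 < r, A `<=` thickening B r & B `<=` thickening A r].
Proof.
move=> ABr; have e0 : 0 < r - hausdorff_dist A B by rewrite subr_gt0.
have [s [s0 AB BA]] := inf_adherent e0 (hset_has_inf A B).
rewrite addrC subrK => /ltW sr; split; first exact: lt_le_trans sr.
  exact/(subset_trans AB)/thickening_le.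
exact/(subset_trans BA)/thickening_le.
Qed.

Fact hausdorff_distxx A : hausdorff_dist A A = 0.
Proof.
apply/eqP; rewrite eq_le; apply/andP; split; last first.
  by apply: lb_le_inf; [exact: (hset_has_inf A A).1 | move=> r [/ltW]].
apply/ler_addgt0Pl => e e0; rewrite addr0.
by apply: hausdorff_dist_le => // x Ax; exists x => //; exact: ballxx.
Qed.

Fact hausdorff_dist_sym A B : hausdorff_dist A B = hausdorff_dist B A.
Proof.
by congr inf; apply/seteqP; split => r [].
Qed.

Fact hausdorff_dist_positivity A B : hausdorff_dist A B = 0 -> A = B.
Proof.
suff sub (A' B' : compacts M) : hausdorff_dist A' B' = 0 -> A' `<=` B'.
  move=> AB; apply/compacts_eq/seteqP; split; apply: sub => //.
  by rewrite hausdorff_dist_sym.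
move=> AB x A'x.
have /closure_id -> : closed B'.
  exact: compact_closed (@metric_hausdorff _ M) (@kset_compact _ _ B').
move=> U /nbhs_ballP[e /= e0 xeU].
have [_ + _] := @hausdorff_dist_gt A' B' e (ltac:(by rewrite AB)).
by move=> /(_ _ A'x)[b B'b bx]; exists b; split=> //; exact/xeU/ball_sym.
Qed.

Fact hausdorff_dist_triangle B A C :
  hausdorff_dist A C <= hausdorff_dist A B + hausdorff_dist B C.
Proof.
apply/ler_addgt0Pr => e e0; have e20 : 0 < e / 2 by rewrite divr_gt0.
have [] := @hausdorff_dist_gt A B (hausdorff_dist A B + e / 2).
  by rewrite ltrDl.
set r := (X in 0 < X) => r0 AB BA.
have [] := @hausdorff_dist_gt B C (hausdorff_dist B C + e / 2).
  by rewrite ltrDl.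
set s := (X in 0 < X) => s0 BC CB.
have -> : hausdorff_dist A B + hausdorff_dist B C + e = r + s.
  by rewrite /r /s [in LHS](splitr e) addrACA.
apply: hausdorff_dist_le; first exact: addr_gt0.
  move=> x /AB[b /BC[c Cc cb] bx]; exists c => //.
  by rewrite addrC; exact: ball_triangle bx.
move=> x /CB[b /BA[c Cc cb] bx]; exists c => //; exact: ball_triangle bx.
Qed.

HB.instance Definition _ := @isMetric.Build R (compacts M) hausdorff_dist
  hausdorff_distxx hausdorff_dist_positivity hausdorff_dist_sym
  hausdorff_dist_triangle.

End hausdorff_metric.

Definition circleK (R : realType) : compacts (circle R) :=
  Compacts (@circle_compact R) (ex_intro _ 0 I).

HB.instance Definition _ (R : realType) :=
  isPointed.Build (compacts (circle R)) (circleK R).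

Section rigidity.
Context {R : realType}.
Implicit Types A : compacts (circle R).

Fact times_compact n A : compact [set x *+ n | x in A].
Proof.
apply: continuous_compact; last exact: kset_compact.
exact/continuous_subspaceT/circle_mulrn_continuous.
Qed.

Fact times_nonempty n A : [set x *+ n | x in A] !=set0.
Proof. by have [x Ax] := kset_nonempty A; exists (x *+ n), x. Qed.

Definition times n A : compacts (circle R) :=
  Compacts (times_compact (n := n) (A := A)) (times_nonempty n A).

(* K(T) with the Borel sigma-algebra of the Hausdorff metric. *)
Definition borelK := g_sigma_algebraType (@open (compacts (circle R))).

Definition invariant_random_compact (mu : probability borelK R) : Prop :=
  forall n, (0 < n)%N -> forall B : set borelK, measurable B ->
    pushforward mu (times n : borelK -> borelK) B = mu B.

Definition countable_compacts : set (compacts (circle R)) :=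
  [set A | countable A].

(* The library's completion is the outer measure of mu, a complete measure on
   the Caratheodory-measurable sets; a value 0 already entails
   measurability for the completion (completion_eq0). *)
Definition completion (mu : probability borelK R) : set borelK -> \bar R :=
  @completed_measure_extension _ _ _ mu.

Lemma completion_eq0 mu (A : set borelK) :
  completion mu A = 0%E <-> mu.-negligible A.
Proof.
rewrite /completion /completed_measure_extension; split => [muA0|[B [mB B0 AB]]].
  have cover n : exists B : set borelK,
      [/\ measurable B, A `<=` B & (mu B <= n.+1%:R^-1%:E)%E].
    have n0 : (0 < n.+1%:R^-1 :> R)%R by rewrite invr_gt0.
    have fA : (mu^*)%mu A \is a fin_num by rewrite muA0.
    have [_/= [F [mF AF] <-]] := lb_ereal_inf_adherent n0 fA.
    rewrite -/(mu_ext mu A) muA0 add0e => /ltW Fn; exists (\bigcup_k F k).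
    have mUF : measurable (\bigcup_k F k) by exact: bigcupT_measurable.
    split => //; apply: le_trans Fn.
    exact: (measure_sigma_subadditive mu mF mUF).
  have [F /all_and3[mF AF muF]] := choice cover.
  have mIF : measurable (\bigcap_n F n : set borelK).
    exact: bigcapT_measurable.
  exists (\bigcap_n F n); split => //; last by move=> x Ax n _; exact: AF.
  apply/eqP; rewrite eq_le measure_ge0 andbT.
  apply/lee_addgt0Pr => /= _/posnumP[e]; rewrite add0e; near \oo => n.
  rewrite (@le_trans _ _ (mu (F n)))//.
    by apply: le_measure; rewrite ?inE//; exact: bigcap_inf.
  rewrite (le_trans (muF n))// lee_fin ltW//.
  by near: n; exact: near_infty_natSinv_lt.
apply/eqP; rewrite eq_le mu_ext_ge0// andbT -B0 -(measurable_mu_extE mu mB).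
exact: le_mu_ext.
Unshelve. all: by end_near. Qed.

(* "The only such mu is the Dirac mass" is read as an equivalence. Measures are
   compared on Borel sets, since their values elsewhere are junk. *)
Definition weakly_IC_rigid : Prop :=
  forall mu : probability borelK R,
    invariant_random_compact mu /\
      completion mu countable_compacts = 0%E <->
    forall B : set borelK, measurable B -> mu B = \d_(circleK R : borelK) B.

End rigidity.

Arguments weakly_IC_rigid R : clear implicits.

(* Main.v *)
Require Import Defs.
From mathcomp Require Import all_boot all_order all_algebra.
From mathcomp Require Import ring lra.
From mathcomp Require Import all_classical all_reals all_analysis.
From mathcomp Require Import measurable_realfun.
Import Order.TTheory GRing.Theory Num.Theory.
Import numFieldNormedType.Exports.

(** Why it is true.  Let [mu] be an invariant random compact and [U] an open
arc, and let [E] be the event that a compact set misses [U].  Each dilation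
preserves [mu], so [mu E] is the [mu]-mean of the proportion of the [n <= N]
for which [n A] misses [U], whatever [N] is.  For every infinite [A] this
proportion tends to [0] as [N] grows ([dilations_rarely_miss_ball]), so
dominated convergence gives [mu E = 0] as soon as almost every compact set is
infinite ([rarely_visited_null]); in particular when almost every one is
uncountable.  The compact sets other than the circle are covered by countably
many such events, one for each rational centre and radius [1 / (k + 1)], hence
[mu] is the Dirac mass at the circle.

That dilations of an infinite set rarely miss an arc is a second moment
computation, which gives a density version of a theorem of Glasner.  Remove the
constant term from the Fejer kernel of order [m]: for [m] large, what remains
is a cosine polynomial that is at most [-1] outside the arc of half-width [e]
around [0] ([fejer_le], [cos_2pi_le_away_from_int]).  Translate this polynomial
so that it is centred at the centre of [U], and evaluate it at [n x_i] for
points [x_0, x_1, ...] of [A].  When [n A] misses [U] all the values are at most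
[-1], so that the square of the sum of the first [k] values is at least
[k ^ 2].  On the other hand the sum of these squares over [n < N] is at most
[C k N + B] with [C] independent of [k]: the [k] diagonal terms are bounded, and
the product of two distinct values is, as a function of [n], a combination of
cosines [cos (n t + b)], with bounded sums over [n < N] as long as
[t / (2 pi)] is not an integer.  That condition means that
[j x_i + j' x_i'] and [j x_i - j' x_i'] do not vanish for [1 <= j, j' <= m]; for
given [x_i] it excludes finitely many values of [x_i'], so an infinite set
contains a sequence of points satisfying it
([infinite_set_avoiding_sequence]).

Conversely, the Dirac mass at the circle is invariant because dilations map the
circle onto itself, and it does not charge the countable compact sets because
the circle is uncountable. *)

Set Implicit Arguments.
Unset Strict Implicit.
Unset Printing Implicit Defensive.

Local Open Scope classical_set_scope.
Local Open Scope ring_scope.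

(** * Sequences of bounded sums *)

Section sums_bounded_above.
Context {R : realType}.
Implicit Types (u v : nat -> R).

(** One-sided boundedness is all that a second moment estimate from above needs,
and lets bounded diagonal terms enter as nonpositive sequences. *)
Definition ubsums u := exists B, forall N, \sum_(n < N) u n <= B.

Lemma eq_ubsums u v : u =1 v -> ubsums u -> ubsums v.
Proof. by move=> /funext ->. Qed.

Lemma ubsums_le0 u : (forall n, u n <= 0) -> ubsums u.
Proof. by move=> u0; exists 0 => N; apply: sumr_le0 => n _; exact: u0. Qed.

Lemma ubsumsD u v : ubsums u -> ubsums v -> ubsums (fun n => u n + v n).
Proof.
move=> [B uB] [C vC]; exists (B + C) => N.
by rewrite big_split; exact: lerD.
Qed.

Lemma ubsums_sum (I : Type) (s : seq I) (P : pred I) (u : I -> nat -> R) :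
  (forall i, P i -> ubsums (u i)) -> ubsums (fun n => \sum_(i <- s | P i) u i n).
Proof.
move=> Pu; elim: s => [|i s IHs].
  by apply: ubsums_le0 => n; rewrite big_nil.
have [Pi|nPi] := boolP (P i).
  have [B] := ubsumsD (Pu i Pi) IHs; exists B => N.
  by under eq_bigr do rewrite big_cons Pi.
have [B] := IHs; exists B => N.
by under eq_bigr do rewrite big_cons (negPf nPi).
Qed.

(** Multiplying by [2 sin (phi / 2)] makes the sum telescope. *)
Lemma ubsums_cos (phi b : R) : sin (phi / 2) != 0 ->
  ubsums (fun n => cos (n%:R * phi + b)).
Proof.
set s := sin _ => s0; exists `|s|^-1 => N.
pose g n := sin (n%:R * phi + b - phi / 2).
have step n : cos (n%:R * phi + b) = (2 * s)^-1 * (g n.+1 - g n).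
  apply: (@mulfI _ (2 * s)); first by rewrite mulf_neq0.
  rewrite mulVKf ?mulf_neq0// /g.
  have -> : n.+1%:R * phi + b - phi / 2 = (n%:R * phi + b) + phi / 2.
    by rewrite -natr1; field.
  by rewrite sinB sinD -/s; ring.
rewrite (eq_bigr (fun n : 'I_N => (2 * s)^-1 * (g n.+1 - g n)))//.
rewrite -mulr_sumr -(big_mkord xpredT (fun n => g n.+1 - g n)) telescope_sumr//.
rewrite invfM mulrAC -mulrA (le_trans (ler_norm _))// !normrM.
rewrite (@ger0_norm _ (2^-1)) ?invr_ge0// normfV.
rewrite mulrA -[leRHS]mul1r ler_wpM2r ?invr_ge0//.
rewrite mulrC ler_pdivrMr// mul1r (le_trans (ler_normB _ _))//.
by rewrite [leRHS](_ : _ = 1 + 1)// lerD// sin_max.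
Qed.

End sums_bounded_above.

(** * The Fejer kernel without its constant term *)

Section fejer.
Context {R : realType}.
Implicit Types (m : nat) (t : R).

(** The sum of the first [m] Dirichlet kernels
[1 + 2 cos t + ... + 2 cos (k t)], minus its mean [m]. *)
Definition fejer m t : R := \sum_(k < m) \sum_(j < k) 2 * cos (j.+1%:R * t).

(** The factor [1 - cos t] makes both the Dirichlet kernels and their sum
telescope. *)
Lemma fejer_closed m t :
  (1 - cos t) * (fejer m t + m%:R) = 1 - cos (m%:R * t).
Proof.
have dirichlet k : (1 - cos t) * (1 + \sum_(j < k) 2 * cos (j.+1%:R * t)) =
    cos (k%:R * t) - cos (k.+1%:R * t).
  elim: k => [|k IHk]; first by rewrite big_ord0 addr0 mulr1 mul0r cos0 mul1r.
  rewrite big_ord_recr/= addrA mulrDr IHk.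
  have -> : k.+2%:R * t = k.+1%:R * t + t by rewrite -(natr1 k.+1); ring.
  have -> : k%:R * t = k.+1%:R * t - t by rewrite -(natr1 k); ring.
  by rewrite cosB cosD; ring.
elim: m => [|m IHm].
  by rewrite /fejer big_ord0 addr0 mulr0 mul0r cos0 subrr.
rewrite /fejer big_ord_recr/= -/(fejer m t).
have := dirichlet m; move: IHm; rewrite -(natr1 m).
by set a := cos (m%:R * t); set b := cos (_ * t); lra.
Qed.

(** Far from [0] the Fejer kernel is bounded independently of [m], so removing
its mean [m] makes it as negative as desired. *)
Lemma fejer_le m t (h : R) : 0 < h -> cos t <= 1 - h ->
  fejer m t <= 2 / h - m%:R.
Proof.
move=> h0 th; rewrite lerBrDr ler_pdivlMr//.
have F0 : 0 <= fejer m t + m%:R.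
  have c0 : 0 < 1 - cos t by lra.
  rewrite -(pmulr_rge0 _ c0) fejer_closed.
  by have := cos_le1 (m%:R * t); lra.
rewrite mulrC (@le_trans _ _ ((1 - cos t) * (fejer m t + m%:R)))//.
  by rewrite ler_wpM2r//; lra.
by rewrite fejer_closed; have := cos_geN1 (m%:R * t); lra.
Qed.

(** The crude bound by the number of terms suffices: only its independence of
[t] matters. *)
Lemma fejer_sqr_le m t : fejer m t ^+ 2 <= ((m * m)%:R * 2) ^+ 2.
Proof.
rewrite -real_normK ?num_real// ler_sqr ?nnegrE ?mulr_ge0//.
rewrite (le_trans (ler_norm_sum _ _ _))//.
have -> : (m * m)%:R * 2 = \sum_(k < m) m%:R * 2 :> R.
  by rewrite sumr_const card_ord natrM -[RHS]mulr_natl mulrA.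
apply: ler_sum => k _; rewrite (le_trans (ler_norm_sum _ _ _))//.
rewrite (@le_trans _ _ (\sum_(j < k) 2))//.
  apply: ler_sum => j _; rewrite normrM ger0_norm//.
  by rewrite -[leRHS]mulr1 ler_wpM2l// cos_max.
by rewrite sumr_const card_ord -[leLHS]mulr_natl ler_wpM2r// ler_nat ltnW.
Qed.

(** No two frequencies, one from the kernel along [n x] and one from the kernel
along [n y], have a sum or difference in [2 pi Z]; the half-angle form is the
one of [ubsums_cos]. *)
Definition nonresonant m (x y : R) := forall i j, (i < m)%N -> (j < m)%N ->
  sin ((i.+1%:R * x + j.+1%:R * y) / 2) != 0 /\
  sin ((i.+1%:R * x - j.+1%:R * y) / 2) != 0.

Lemma nonresonant_sym m x y : nonresonant m x y -> nonresonant m y x.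
Proof.
move=> xy i j im jm; have [p q] := xy _ _ jm im; split.
  by rewrite addrC.
by rewrite -oppr_eq0 -sinN -mulNr opprB.
Qed.

(** By the product-to-sum formula the product is a combination of cosines whose
frequencies are excluded from [2 pi Z] by nonresonance. *)
Lemma ubsums_fejerM m (x y b c : R) : nonresonant m x y ->
  ubsums (fun n => fejer m (n%:R * x + b) * fejer m (n%:R * y + c)).
Proof.
move=> xy.
apply: (@eq_ubsums _ (fun n => \sum_(k < m) \sum_(l < m) \sum_(i < k) \sum_(j < l)
    (2 * cos (i.+1%:R * (n%:R * x + b))) * (2 * cos (j.+1%:R * (n%:R * y + c))))).
  move=> n; rewrite /fejer mulr_suml; apply: eq_bigr => k _.
  rewrite mulr_sumr; apply: eq_bigr => l _.
  rewrite mulr_suml; apply: eq_bigr => i _.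
  by rewrite mulr_sumr.
do 2 (apply: ubsums_sum => ? _).
apply: ubsums_sum => i _; apply: ubsums_sum => j _.
have im : (i < m)%N by exact: ltn_trans (ltn_ord _).
have jm : (j < m)%N by exact: ltn_trans (ltn_ord _).
have [/ubsums_cos p /ubsums_cos q] := xy _ _ im jm.
set b' := i.+1%:R * b; set c' := j.+1%:R * c.
apply: eq_ubsums (ubsumsD (ubsumsD (p (b' + c')) (p (b' + c')))
                          (ubsumsD (q (b' - c')) (q (b' - c')))) => n /=.
have -> : n%:R * (i.+1%:R * x + j.+1%:R * y) + (b' + c') =
  i.+1%:R * (n%:R * x + b) + j.+1%:R * (n%:R * y + c) by rewrite /b' /c'; ring.
have -> : n%:R * (i.+1%:R * x - j.+1%:R * y) + (b' - c') =
  i.+1%:R * (n%:R * x + b) - j.+1%:R * (n%:R * y + c) by rewrite /b' /c'; ring.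
by rewrite cosB cosD; ring.
Qed.

End fejer.

(** * Frequencies from second moments *)

Section density.
Context {R : realType}.

Lemma cvg_frequency0 (C : R) (c : nat -> bool) :
  (forall k, (0 < k)%N -> exists B, forall N,
     k%:R * \sum_(n < N) (c n)%:R <= C * N%:R + B) ->
  (fun N => (\sum_(n < N) (c n)%:R) / N%:R : R) @ \oo --> (0 : R).
Proof.
move=> Ck; apply/cvgrPdist_le => /= e e0.
(* [k] is chosen with [C / k < e / 2]; then [N] absorbs [B] in [e / 2]. *)
pose k := (Num.truncn (`|C| * 2 / e)).+1.
have ke : `|C| * 2 / e < k%:R by exact: truncnS_gt.
have k0 : (0 : R) < k%:R by rewrite ltr0n.
have [B HB] := Ck k isT.
near=> N.
have N0 : (0 : R) < N%:R by rewrite ltr0n; near: N; exact: nbhs_infty_gt.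
rewrite sub0r normrN ger0_norm; last by rewrite divr_ge0// sumr_ge0.
rewrite ler_pdivrMr// -(ler_pM2l k0).
apply: (le_trans (HB N)).
have h1 : C * N%:R <= k%:R * e / 2 * N%:R.
  rewrite ler_wpM2r// (le_trans (ler_norm _))// ler_pdivlMr//.
  by rewrite -ler_pdivrMr// ltW.
have h2 : B <= k%:R * e / 2 * N%:R.
  rewrite -ler_pdivrMl ?divr_gt0 ?mulr_gt0//.
  by near: N; exact: nbhs_infty_ger.
rewrite (le_trans (lerD h1 h2))// -mulrDl mulrA ler_wpM2r//.
by rewrite [leRHS]splitr.
Unshelve. all: by end_near. Qed.

(** Chebyshev's inequality for the sum of the first [k] sequences: it is at most
[-k] at every [n] with [c n], while its squares sum to at most [k C N + B] over
[n < N], the cross terms contributing to [B] only. *)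
Lemma frequency0_of_almost_orthogonal (u : nat -> nat -> R) (C : R)
    (c : nat -> bool) :
  (forall i n, u i n ^+ 2 <= C) ->
  (forall i j, i != j -> ubsums (fun n => u i n * u j n)) ->
  (forall n, c n -> forall i, u i n <= -1) ->
  (fun N => (\sum_(n < N) (c n)%:R) / N%:R : R) @ \oo --> (0 : R).
Proof.
move=> uC uu cu; apply: (@cvg_frequency0 C) => k k0.
have k0' : (0 : R) < k%:R by rewrite ltr0n.
pose S n := \sum_(i < k) u i n.
have [B HB] : ubsums (fun n => \sum_(i < k)
    ((u i n ^+ 2 - C) + \sum_(j < k | i != j) u i n * u j n)).
  apply: ubsums_sum => i _; apply: ubsumsD.
    by apply: ubsums_le0 => n; rewrite subr_le0.
  by apply: ubsums_sum => j ij; exact: uu.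
have SE n : S n ^+ 2 = \sum_(i < k)
    ((u i n ^+ 2 - C) + \sum_(j < k | i != j) u i n * u j n) + k%:R * C.
  have -> : k%:R * C = \sum_(i < k) C by rewrite sumr_const card_ord mulr_natl.
  rewrite -big_split/= expr2 {1}/S mulr_suml; apply: eq_bigr => i _.
  rewrite mulr_sumr (bigD1 i)//= -expr2 addrAC subrK; congr (_ + _).
  by apply: eq_bigl => j; rewrite eq_sym.
have cS n : k%:R ^+ 2 * (c n)%:R <= S n ^+ 2.
  have [cn|_] := boolP (c n); last by rewrite mulr0 sqr_ge0.
  have Sk : S n <= - k%:R.
    apply: (@le_trans _ _ (\sum_(i < k) -1)); first by apply: ler_sum => i _; exact: cu.
    by rewrite sumr_const card_ord mulNrn.
  rewrite mulr1 -[leRHS]sqrrN ler_sqr ?nnegrE//; first by rewrite lerNr.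
  by rewrite oppr_ge0 (le_trans Sk)// oppr_le0.
exists (B / k%:R) => N; rewrite -(ler_pM2l k0') mulrA -expr2.
rewrite mulr_sumr (le_trans (ler_sum _ (fun (n : 'I_N) _ => cS n)))//.
under eq_bigr do rewrite SE.
rewrite big_split/= sumr_const card_ord -[X in _ + X <= _]mulr_natl mulrDr.
rewrite [k%:R * (B / _)]mulrC divfK ?gt_eqF//.
have -> : k%:R * (C * N%:R) = N%:R * (k%:R * C) by ring.
by rewrite [leRHS]addrC lerD2r; exact: HB.
Qed.

End density.

(** * Angles on the circle *)

Section circle_angles.
Context {R : realType}.
Implicit Types (t e : R) (x y z : circle R) (m n : nat).

Lemma sin_pi_eq0_int t : sin (pi * t) = 0 -> t \is a Num.int.
Proof.
wlog t0 : t / 0 <= t => [H|].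
  have [/H//|/ltW t0 st] := leP 0 t.
  by rewrite -rpredN H ?oppr_ge0// mulrN sinN st oppr0.
have /andP[nt tn] := truncn_itv t0; set n := Num.truncn t in nt tn.
have -> : pi * t = pi * (t - n%:R) + pi *+ n by rewrite -mulr_natr; ring.
rewrite (alternatingn (@sinDpi R)) => /eqP; rewrite mulf_eq0 signr_eq0/= => /eqP st.
have [r0|r0] := eqVneq (t - n%:R) 0; first by rewrite (subr0_eq r0) natr_int.
have r_gt0 : 0 < t - n%:R by rewrite lt_def r0 subr_ge0.
have r_lt1 : t - n%:R < 1 by rewrite ltrBlDl natr1.
suff : 0 < sin (pi * (t - n%:R)) by rewrite st ltxx.
apply: sin_gt0_pi; rewrite mulr_gt0 ?pi_gt0//=.
by rewrite -[ltRHS]mulr1 ltr_pM2l ?pi_gt0.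
Qed.

Lemma cos_2pi_int t e : t - e \is a Num.int ->
  cos (2 * pi * t) = cos (2 * pi * e).
Proof.
wlog te : t e / e <= t => [H|].
  have [/H//|/ltW te ite] := leP e t.
  by rewrite (H e t)// -rpredN opprB.
rewrite intrEge0 ?subr_ge0// => /natrP[n ten].
have -> : 2 * pi * t = 2 * pi * e + pi *+ 2 *+ n.
  by rewrite -(subrK e t) ten -(mulr_natr _ n) -(mulr_natr pi 2); ring.
by rewrite (periodicn (@cosD2pi R)).
Qed.

(** The bound is uniform: after reduction modulo [1] and reflection, the point
lies in [[e, 1/2]], on which the cosine of [2 pi t] decreases. *)
Lemma cos_2pi_le_away_from_int e : 0 < e -> exists2 h : R, 0 < h &
  forall t, e <= circle_norm (circle_proj t) -> cos (2 * pi * t) <= 1 - h.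
Proof.
move=> e0.
(* [e] may exceed [1/2], the largest value of the norm. *)
pose d : R := Num.min e 2^-1.
have d0 : 0 < d by rewrite /d lt_min e0/= invr_gt0.
have d2 : d <= 2^-1 by rewrite /d ge_min lexx orbT.
have p0 : 0 < 2 * pi :> R by rewrite mulr_gt0// pi_gt0.
have in0pi t : 0 <= t -> t <= 2^-1 -> 2 * pi * t \in `[0, pi].
  move=> t0 t2; rewrite in_itv/= mulr_ge0 ?(ltW p0)//=.
  by rewrite mulrAC ger_pMl ?pi_gt0// -ler_pdivlMl// mulr1.
exists (1 - cos (2 * pi * d)).
  rewrite subr_gt0 -[ltRHS]cos0 ltr_cos ?in0pi ?(ltW d0)//; first exact: mulr_gt0.
  by rewrite in_itv/= lexx pi_ge0.
have near t : 0 <= t -> t <= 2^-1 -> e <= circle_norm (circle_proj t) ->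
    cos (2 * pi * t) <= 1 - (1 - cos (2 * pi * d)).
  move=> t0 t2 et; rewrite subKr.
  have dt : d <= t.
    by rewrite /d ge_min (le_trans et)// -[leRHS]ger0_norm// circle_norm_proj.
  rewrite leNgt ltr_cos ?in0pi// ?(ltW d0)// -leNgt.
  by rewrite ler_pM2l.
move=> t; set s := t - (Num.floor t)%:~R.
have ts : t - s \is a Num.int by rewrite /s subKr intr_int.
have /eqP -> : circle_proj t == circle_proj s by rewrite circle_proj_eq.
rewrite (cos_2pi_int ts) => es.
have s0 : 0 <= s by rewrite subr_ge0 floor_le_tmp.
have s1 : s < 1 by rewrite ltrBlDl -intrD1 floorD1_gt.
have [s2|/ltW s2] := leP s 2^-1; first exact: near.
have -> : cos (2 * pi * s) = cos (2 * pi * (1 - s)).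
  rewrite -[RHS]cosN -mulrN; apply: cos_2pi_int.
  by rewrite opprB subKr rpred1.
apply: near; [by rewrite subr_ge0 ltW|lra|].
have /eqP -> : circle_proj (1 - s) == - circle_proj s.
  by rewrite -raddfN circle_proj_eq opprK subrK rpred1.
by rewrite circle_normN.
Qed.

Definition angle x : R := 2 * pi * repr x.

Lemma circle_proj_repr x : circle_proj (repr x) = x.
Proof. by rewrite /circle_proj reprK. Qed.

(** Lifts of [y] differ from [repr z / (n + 1)] by an integer multiple of
[1 / (n + 1)], and modulo [1] only [n + 1] multiples are distinct. *)
Lemma finite_circle_division n z : finite_set [set y : circle R | y *+ n.+1 = z].
Proof.
apply: (@sub_finite_set _ _
  ((fun k => circle_proj ((repr z + k%:R) / n.+1%:R)) @` `I_n.+1)); last first.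
  exact/finite_image/finite_II.
move=> y /= yz.
have : repr y * n.+1%:R - repr z \is a Num.int.
  by rewrite -circle_proj_eq mulr_natr raddfMn/= !circle_proj_repr yz.
move=> /intrP[l yzl].
have n0 : n.+1%:Z != 0 by [].
exists `|(l %% n.+1%:Z)%Z|%N => /=.
  rewrite -ltz_nat gez0_abs ?modz_ge0//; exact: ltz_pmod.
apply/eqP; rewrite -(circle_proj_repr y) circle_proj_eq.
have -> : (`|(l %% n.+1%:Z)%Z|%N)%:R = ((l %% n.+1%:Z)%Z)%:~R :> R.
  by rewrite -[LHS]/((`|(l %% n.+1%:Z)%Z|%N%:Z)%:~R) gez0_abs ?modz_ge0.
have ly : repr y = (repr z + l%:~R) / n.+1%:R.
  by rewrite -yzl addrC subrK mulfK.
rewrite [X in _ - X]ly -mulrBl opprD addrACA subrr add0r.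
rewrite [X in _ - X](_ : _ =
  (l %/ n.+1%:Z)%Z%:~R * n.+1%:R + (l %% n.+1%:Z)%Z%:~R); last first.
  by rewrite {1}(divz_eq l n.+1%:Z) intrD intrM.
rewrite opprD addrCA subrr addr0.
by rewrite mulNr mulfK// rpredN intr_int.
Qed.

(** The points that cannot follow [x] in a sequence of pairwise nonresonant
points. *)
Definition resonances m x : set (circle R) :=
  [set y | exists i j, [/\ (i < m)%N, (j < m)%N &
    x *+ i.+1 + y *+ j.+1 = 0 \/ x *+ i.+1 - y *+ j.+1 = 0]].

Lemma finite_resonances m x : finite_set (resonances m x).
Proof.
pose D (j : nat) z := [set y : circle R | y *+ j.+1 = z].
apply: (@sub_finite_set _ _ (\bigcup_(i in `I_m) \bigcup_(j in `I_m)
  (D j (- (x *+ i.+1)) `|` D j (x *+ i.+1)))); last first.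
  apply: bigcup_finite => [|i _]; first exact: finite_II.
  apply: bigcup_finite => [|j _]; first exact: finite_II.
  by rewrite finite_setU; split; exact: finite_circle_division.
move=> y [i [j [im jm xy]]]; exists i => //; exists j => //.
case: xy => [/eqP|/subr0_eq ->]; last by right.
by rewrite addrC addr_eq0 => /eqP; left.
Qed.

Lemma nonresonant_angle m x y : ~ resonances m x y ->
  nonresonant m (angle x) (angle y).
Proof.
move=> xy i j im jm.
have ne0 (s : R) : circle_proj s != 0 -> sin (pi * s) != 0.
  apply: contra_neq => /sin_pi_eq0_int si; apply/eqP.
  by rewrite -(raddf0 (@circle_proj R)) circle_proj_eq subr0.
have -> : (i.+1%:R * angle x + j.+1%:R * angle y) / 2 =
  pi * (repr x *+ i.+1 + repr y *+ j.+1).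
  by rewrite /angle -(mulr_natr (repr x)) -(mulr_natr (repr y)); field.
have -> : (i.+1%:R * angle x - j.+1%:R * angle y) / 2 =
  pi * (repr x *+ i.+1 - repr y *+ j.+1).
  by rewrite /angle -(mulr_natr (repr x)) -(mulr_natr (repr y)); field.
split; apply: ne0; apply/eqP => xy0; apply: xy; exists i, j; split => //.
  by left; move: xy0; rewrite raddfD !raddfMn/= !circle_proj_repr.
by right; move: xy0; rewrite raddfB !raddfMn/= !circle_proj_repr.
Qed.

End circle_angles.

(** * Dilations of an infinite set *)

(** Greedy choice: the points chosen so far forbid finitely many points. *)
Lemma infinite_set_avoiding_sequence (T : choiceType) (A : set T)
    (bad : T -> set T) :
  infinite_set A -> (forall x, finite_set (bad x)) ->
  exists x : nat -> T, (forall i, A (x i)) /\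
    (forall i j, (i < j)%N -> ~ bad (x i) (x j)).
Proof.
move=> Ainf badfin.
have next (s : seq T) : exists y, A y /\ forall x, x \in s -> ~ bad x y.
  have [y [Ay sy]] : A `\` \bigcup_(x in [set` s]) bad x !=set0.
    apply/infinite_setN0/infinite_setD => //.
    by apply: bigcup_finite => //; exact: finite_seq.
  by exists y; split => // x xs xy; apply: sy; exists x.
have [f Hf] := choice next.
(* [s n] lists the first [n] points, the latest first. *)
pose s := fix s n := if n is n'.+1 then f (s n') :: s n' else [::].
exists (fun n => f (s n)); split=> [i|i j ij]; first exact: (Hf _).1.
apply: (Hf (s j)).2; elim: j ij => // j IHj.
by rewrite ltnS leq_eqVlt inE => /predU1P[->|/IHj ->]; rewrite ?eqxx ?orbT.
Qed.

(** Given one point, only finitely many others resonate with it at the finitely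
many frequencies of the kernel, so [A] contains a sequence of points along which
the values of the kernel at the dilates are almost orthogonal. *)
Lemma dilations_rarely_miss_ball (R : realType) (A : set (circle R))
    (a : circle R) (e : R) :
  0 < e -> infinite_set A ->
  (fun N => (\sum_(n < N)
      (`[< forall x, A x -> ~ ball a e (x *+ n.+1) >] : bool)%:R) / N%:R : R)
    @ \oo --> (0 : R).
Proof.
move=> e0 Ainf; have [h h0 Hh] := cos_2pi_le_away_from_int e0.
pose m := (Num.truncn (2 / h + 1)).+1.
have mh : 2 / h - m%:R <= -1.
  by have : 2 / h + 1 < m%:R := truncnS_gt _; lra.
have [x [Ax xx]] :=
  infinite_set_avoiding_sequence Ainf (@finite_resonances R m).
(* The dilations are [n + 1], and the kernel is centred at [a]. *)
pose b i := angle (x i) - angle a.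
pose u i n := fejer m (n%:R * angle (x i) + b i).
apply: (@frequency0_of_almost_orthogonal _ u (((m * m)%:R * 2) ^+ 2)
  (fun n => `[< forall x, A x -> ~ ball a e (x *+ n.+1) >])).
- by move=> i n; exact: fejer_sqr_le.
- move=> i j ij; apply: ubsums_fejerM.
  have [lij|lji|/eqP] := ltngtP i j; last by rewrite (negPf ij).
    exact/nonresonant_angle/xx.
  exact/nonresonant_sym/nonresonant_angle/xx.
move=> n /asboolP miss i; apply: le_trans mh; apply: fejer_le => //.
have -> : n%:R * angle (x i) + b i = 2 * pi * (repr (x i) *+ n.+1 - repr a).
  by rewrite /b /angle -mulr_natr -natr1; ring.
apply: Hh; rewrite raddfB raddfMn/= !circle_proj_repr.
have := miss _ (Ax i); rewrite ballEmdist/= circle_mdistE => /negP.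
by rewrite -leNgt -circle_normN opprB.
Qed.

(** * Rarely visited events *)

Section rare_visits.
Context d (T : measurableType d) (R : realType).

(** The mean of the visit frequency up to any time is [c], and it tends to [0] by
dominated convergence. *)
Lemma rarely_visited_null (mu : probability T R) (E : nat -> set T) (c : \bar R) :
  (forall n, measurable (E n)) -> (forall n, mu (E n) = c) ->
  {ae mu, forall x, (fun N => (\sum_(n < N) (x \in E n)%:R) / N%:R : R)
    @ \oo --> (0 : R)} ->
  c = 0%E.
Proof.
move=> mE muE freq0.
pose f N x : R := N.+1%:R^-1 * \sum_(n < N.+1) \1_(E n) x.
have mind n : measurable_fun [set: T] (\1_(E n) : T -> R).
  exact: measurable_indic.
have mf N : measurable_fun [set: T] (fun x => (f N x)%:E).
  apply/measurable_EFinP; apply: measurable_funM => //.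
  exact: measurable_sum.
have f_ge0 N x : 0 <= f N x by rewrite /f mulr_ge0 ?invr_ge0 ?sumr_ge0.
have f_le1 N x : f N x <= 1.
  rewrite /f ler_pdivrMl// mulr1.
  rewrite (@le_trans _ _ (\sum_(n < N.+1) 1))//.
    by apply: ler_sum => n _; rewrite indicE; case: (_ \in _).
  by rewrite sumr_const card_ord.
have cfin : c \is a fin_num by rewrite -(muE 0%N) fin_num_measure.
have intf N : (\int[mu]_x (f N x)%:E = c)%E.
  transitivity (\int[mu]_x ((N.+1%:R^-1)%:E * \sum_(n < N.+1) (\1_(E n) x)%:E))%E.
    by apply: eq_integral => x _; rewrite /f EFinM sumEFin.
  rewrite ge0_integralZl//; first last.
  - by move=> x _; apply: sume_ge0 => n _; rewrite lee_fin.
  - by apply: emeasurable_sum => n; exact/measurable_EFinP.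
  rewrite ge0_integral_sum//; last first.
    by move=> n; exact/measurable_EFinP.
  have intE n : (\int[mu]_x (\1_(E n) x)%:E = c)%E.
    by rewrite integral_indic// setIT; exact: muE.
  rewrite (eq_bigr (fun=> c)); last by move=> n _; exact: intE.
  rewrite -(fineK cfin) sumEFin sumr_const card_ord -EFinM.
  by rewrite -(mulr_natl (fine c)) mulKf.
have fcvg : {ae mu, forall x, setT x -> (fun N => (f N x)%:E) @ \oo --> 0%E}.
  apply: filterS freq0 => x xE _; apply: cvg_EFin; first exact: nearW.
  rewrite -(cvg_shiftS) in xE.
  by apply: cvg_trans xE; apply: near_eq_cvg; apply: nearW => N; rewrite /f/= mulrC.
have f_dom : {ae mu, forall x n, setT x -> (`|(f n x)%:E| <= cst 1 x)%E}.
  by apply: aeW => x n _; rewrite /= lee_fin ger0_norm.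
have [_ _] := dominated_convergence measurableT mf (measurable_cst 0%E) fcvg
  (finite_measure_integrable_cst mu 1 measurableT) f_dom.
rewrite integral0; under eq_fun do rewrite intf.
move=> c0; apply: (cvg_unique (@ereal_hausdorff R) _ c0); exact: cvg_cst.
Qed.

End rare_visits.

(** * Borel sets of compact sets *)

Section misses.
Context {R : realType} {M : metricType R}.

Definition misses (U : set M) : set (compacts M) := [set A | A `&` U = set0].

Lemma open_metric_ball (a : M) (r : R) : open (ball a r).
Proof.
rewrite openE => x; rewrite ballEmdist/= => axr.
apply/nbhs_ballP; exists (r - mdist a x); first by rewrite /= subr_gt0.
move=> y; rewrite !ballEmdist/= => xy.
by rewrite (le_lt_trans (metric_triangle a x y))// -ltrBrDl.
Qed.

(** A set that meets [U] does so together with a ball around the common point,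
and compact sets close to it meet that ball. *)
Lemma closed_misses (U : set M) : open U -> closed (misses U).
Proof.
move=> oU; rewrite -[misses U]setCK; apply: open_closedC.
rewrite openE => A /= /eqP/set0P[a [Aa Ua]].
have /nbhs_ballP[r /= r0 rU] : nbhs a U by exact: open_nbhs_nbhs.
apply/nbhs_ballP; exists r => //= B.
rewrite ballEmdist/= => /hausdorff_dist_gt[_ AB _].
have [b Bb ba] := AB _ Aa.
by apply/eqP/set0P; exists b; split => //; exact/rU/ball_sym.
Qed.

End misses.

Section borel.
Context {R : realType}.
Local Notation T := (circle R).
Local Notation K := (compacts (circle R)).

Lemma open_borelK (U : set (borelK (R := R))) : open (U : set K) -> measurable U.
Proof. by move=> oU; exact: sub_sigma_algebra. Qed.

Lemma closed_borelK (F : set (borelK (R := R))) : closed (F : set K) -> measurable F.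
Proof.
move=> cF; rewrite -[F]setCK; apply: measurableC.
apply: open_borelK; exact: (@closed_openC K F cF).
Qed.

Lemma continuous_times n : continuous (@times R n : K -> K).
Proof.
have thick (A B : K) (r : R) : A `<=` thickening B (r / n.+1%:R) ->
    times n A `<=` thickening (times n B) r.
  move=> AB _ [x /AB[y By yx] <-]; exists (y *+ n); first by exists y.
  move: yx; rewrite !ballEmdist/= !circle_mdistE -mulrnBl ltr_pdivlMr// => xyn.
  rewrite (le_lt_trans (circle_norm_mulrn _ _))// (le_lt_trans _ xyn)//.
  rewrite -[leLHS]mulr_natr ler_wpM2l ?ler_nat//.
  by rewrite -circle_mdistE mdist_ge0.
move=> A; apply/(@cvg_ballP _ K _ _ (nbhs_filter A)) => e e0.
apply/nbhs_ballP; exists (e / 2 / n.+1%:R) => /=; first by rewrite !divr_gt0.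
move=> B; rewrite !ballEmdist/= => /hausdorff_dist_gt[_ AB BA].
apply: (@le_lt_trans _ _ (e / 2)); last by lra.
by apply: hausdorff_dist_le; [rewrite divr_gt0|exact: thick|exact: thick].
Qed.

Lemma measurable_times n (B : set (borelK (R := R))) : measurable B ->
  measurable ((times n : borelK -> borelK) @^-1` B).
Proof.
move=> mB; rewrite -[X in measurable X]setTI.
apply: (@measurability _ _ borelK borelK setT (times n) (@open K)) => //.
move=> _ [U oU <-]; rewrite setTI; apply: open_borelK.
by have /continuousP := @continuous_times n; apply.
Qed.

(** The real line is a countable union of translates of a set of lifts, so it
would be countable and have Lebesgue measure [0]. *)
Lemma circle_uncountable : ~ countable [set: T].
Proof.
move=> cT.
pose shifts (p : T * int) : R := repr p.1 + p.2%:~R.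
have cR : countable [set: R].
  have := countableX cT (countableP [set: int]).
  rewrite setXTT; apply: sub_countable; apply: card_le_trans (card_image_le shifts _).
  apply: subset_card_le => r _.
  have : r - repr (circle_proj r) \is a Num.int.
    by rewrite -circle_proj_eq circle_proj_repr.
  move=> /intrP[n rn]; exists (circle_proj r, n) => //.
  by rewrite /shifts/= -rn addrC subrK.
have : lebesgue_measure [set: R] = 0%E by exact: countable_lebesgue_measure0.
suff : (0 < @lebesgue_measure R [set: R])%E by move=> /[swap] ->; rewrite ltxx.
apply: (@lt_le_trans _ _ (lebesgue_measure `[0%R, 1%R])).
  by rewrite lebesgue_measure_itv/= lte_fin ltr01 sube0 lte_fin.
by apply: le_measure; rewrite ?inE//; exact: measurable_itv.
Qed.

(** * Invariance and the Dirac mass *)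

Definition misses_arc (q : rat) (k : nat) : set K :=
  misses (ball (circle_proj (ratr q)) k.+1%:R^-1).

Lemma not_circleK_misses_arc (A : K) : A <> circleK R -> exists q k, misses_arc q k A.
Proof.
move=> AT; have [x nAx] : exists x, ~ (A : set T) x.
  apply: contrapT => nx; apply: AT; apply/compacts_eq/seteqP; split => // x _.
  by apply: contrapT => nAx; apply: nx; exists x.
have oA : open (~` (A : set T)).
  apply: closed_openC; apply: compact_closed (@kset_compact _ _ A).
  exact: metric_hausdorff.
have /nbhs_ballP[e /= e0 eA] : nbhs x (~` (A : set T)) by exact: open_nbhs_nbhs.
(* A ball of radius [1 / (k + 1)] centred within [1 / (k + 1)] of [x] stays
   within [e] of [x]. *)
have [k ke] : exists k, 2 * k.+1%:R^-1 < e :> R.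
  exists (Num.truncn (2 / e)); rewrite ltr_pdivrMr// mulrC -ltr_pdivrMr//.
  exact: truncnS_gt.
have k0 : 0 < k.+1%:R^-1 :> R by rewrite invr_gt0.
have [r xr] := circle_proj_surj x.
have [|q] := @rat_in_itvoo R (r - k.+1%:R^-1) (r + k.+1%:R^-1).
  by rewrite ltrBlDr -addrA ltrDl addr_gt0.
rewrite in_itv/= => /andP[rq qr].
exists q, k; apply/seteqP; split => // y [Ay qy]; apply: (eA y) => //.
apply: (@le_ball _ _ _ _ _ (ltW ke)); rewrite mulr_natl mulr2n.
apply: ball_triangle qy; rewrite ballEmdist/= circle_mdistE -xr -raddfB.
rewrite (le_lt_trans (circle_norm_proj _))//.
rewrite ltr_norml ltrBlDl -ltrBlDr rq andbT.
by rewrite ltrBrDr addrC ltrBlDr.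
Qed.

(** Each arc is missed with probability [0], by [dilations_rarely_miss_ball] and
[rarely_visited_null]; countably many arcs detect every compact set other than
the circle. *)
Lemma invariant_ae_infinite_ae_full (mu : probability (borelK (R := R)) R) :
  invariant_random_compact mu ->
  {ae mu, forall A : borelK, infinite_set ((A : K) : set T)} ->
  mu.-negligible [set A : borelK | A <> circleK R].
Proof.
move=> inv muinf.
have mm q k : measurable (misses_arc q k : set borelK).
  by apply: closed_borelK; exact: (closed_misses (@open_metric_ball R T _ _)).
have null q k : mu (misses_arc q k) = 0%E.
  apply: (@rarely_visited_null _ borelK R mu
    (fun n => (times n.+1 : borelK -> borelK) @^-1` misses_arc q k)).
  - by move=> n; exact: measurable_times.
  - by move=> n; exact: inv.
  apply: filterS muinf => A Ainf.
  have k0 : 0 < k.+1%:R^-1 :> R by rewrite invr_gt0.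
  have := dilations_rarely_miss_ball (circle_proj (ratr q)) k0 Ainf.
  apply: cvg_trans; apply: near_eq_cvg; apply: nearW => N /=.
  congr (_ / _); apply: eq_bigr => n _; congr ((nat_of_bool _)%:R).
  apply/idP/idP => [/asboolP AU|/set_mem AU].
    apply/mem_set/seteqP; split => // y [[x Ax <-]]; exact: AU.
  apply/asboolP => x Ax xU; suff : set0 (x *+ n.+1) by [].
  by rewrite -AU; split => //; exists x.
apply: (@negligibleS _ _ _ _ (\bigcup_n
    if unpickle n is Some (q, k) then misses_arc q k : set borelK else set0)).
  move=> A /not_circleK_misses_arc[q [k Aqk]].
  exists (pickle (q, k)); first exact: I.
  by rewrite pickleK.
apply: negligible_bigcup => n; case: unpickle => [[q k]|].
  by exists (misses_arc q k); split => //; exact: null.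
exact: negligible_set0.
Qed.

End borel.

Theorem corollary5p3 (R : realType) : weakly_IC_rigid R.
Proof.
move=> mu.
have mT : measurable ([set circleK R] : set borelK).
  apply: closed_borelK; apply: (@accessible_closed_set1 (compacts (circle R))).
  exact/hausdorff_accessible/metric_hausdorff.
split=> [[inv /completion_eq0 ct0] B mB|muE].
  have [N [mN N0 TN]] : mu.-negligible [set A : borelK | A <> circleK R].
    apply: invariant_ae_infinite_ae_full => //.
    apply: negligibleS ct0 => A /= Afin.
    by apply: finite_set_countable; exact: contrapT.
  (* [mu] and the Dirac mass agree on the Borel sets that do not contain the
     circle, hence on their complements. *)
  have null (C : set borelK) : measurable C -> ~ C (circleK R) -> mu C = 0%E.
    move=> mC nC; apply/eqP; rewrite eq_le measure_ge0 andbT -N0.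
    apply: le_measure; rewrite ?inE// => A CA; apply: TN => AT.
    by apply: nC; rewrite -AT.
  rewrite diracE; have [BT|nBT] := pselect (B (circleK R)).
    rewrite mem_set// -[B]setCK probability_setC ?null//; last exact: measurableC.
      by rewrite sube0.
    exact: measurableC.
  by rewrite memNset// null.
split=> [n n0 B mB|].
  rewrite /pushforward !muE//; last exact: measurable_times.
  have nT : times n (circleK R) = circleK R.
    apply/compacts_eq/seteqP; split => // x _ /=.
    (* The circle is divisible. *)
    exists (circle_proj (repr x / n%:R)) => //.
    rewrite -raddfMn/= -[X in circle_proj X]mulr_natr divfK ?circle_proj_repr//.
    by rewrite pnatr_eq0 -lt0n.
  rewrite !diracE; congr ((nat_of_bool _)%:R%:E).
  by apply/idP/idP; rewrite !inE /= nT.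
apply/completion_eq0; exists (~` [set circleK R]); split.
- exact: measurableC.
- rewrite muE ?diracE; last exact: measurableC.
  by rewrite memNset//=; apply.
- by move=> A /= cA AT; apply: (@circle_uncountable R); rewrite AT in cA.
Qed.
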